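(* For any sequence $\mathbf{s}=(s_1,s_2,\ldots)$ of positive integers and any $n\ge 1$, the polynomial $Q_n^{(\mathbf{s})}(x)$ is unimodal.
   Context: For a sequence $\mathbf{s}$ of positive integers and $n\ge1$, let $\mathbf{v}_i=(0,\ldots,0,s_i,s_{i+1},\ldots,s_n)\in\mathbb{R}^n$ (first $i-1$ coordinates zero) for $1\le i\le n$, and let $\Pi_n^{(\mathbf{s})}=\left\{\sum_{i=1}^n\alpha_i\mathbf{v}_i \mid 0\le\alpha_i<1\right\}$. The $n$th inflated $\mathbf{s}$-Eulerian polynomial is $$Q_n^{(\mathbf{s})}(x)=\sum_{\lambda\in\Pi_n^{(\mathbf{s})}\cap\mathbb{Z}^n}x^{\lambda_n}.$$ A sequence $(a_0,a_1,\ldots,a_d)$ is unimodal if there is an integer $0\le t\le d$ such that $a_0\le a_1\le\cdots\le a_t>a_{t+1}\ge a_{t+2}\ge\cdots\ge a_d$ (with $t=d$ allowed). A polynomial $\sum_{k=0}^d a_kx^k$ of degree $d$ is unimodal if its sequence of coefficients $(a_0,a_1,\ldots,a_d)$ is unimodal. *)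

(* Defs.v *)
From HB Require Import structures.
From mathcomp Require Import all_boot all_order all_algebra.
From mathcomp Require Import boolp classical_sets functions cardinality fsbigop.
From mathcomp Require Import reals.

Set Implicit Arguments.
Unset Strict Implicit.
Unset Printing Implicit Defensive.

Import Order.TTheory GRing.Theory Num.Theory.

Local Open Scope classical_set_scope.
Local Open Scope ring_scope.

(* Sequences are indexed from 1: [s i] is s_i for i >= 1, and [s 0] is never
   used. Coordinates of vectors and indices of the vectors v_i are ordinals,
   which start at 0, whence the successors. *)

Definition pvec (R : realType) (s : nat -> nat) (n : nat) (i : 'I_n) : 'rV[R]_n :=
  \row_(j < n) (if (i <= j)%N then (s j.+1)%:R else 0).

Definition parallelepiped (R : realType) (s : nat -> nat) (n : nat) :
    set 'rV[R]_n :=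
  [set x | exists alpha : 'I_n -> R,
     (forall i, 0 <= alpha i < 1) /\ x = \sum_(i < n) alpha i *: pvec R s i].
Arguments parallelepiped : clear implicits.

Definition lattice_points (R : realType) (n : nat) (A : set 'rV[R]_n) :
    set 'rV[int]_n :=
  [set l | A (map_mx intr l)].

(* The value at n = 0 is irrelevant. *)
Definition last_coord (n : nat) : 'rV[int]_n -> int :=
  match n with
  | 0 => fun=> 0
  | m.+1 => fun l => l 0 (ord_max : 'I_m.+1)
  end.

(* [\sum_(l \in A)] sums over all of A when A is finite, as is the case here
   because the parallelepiped is bounded. The last coordinate of a point of the
   parallelepiped is nonnegative, so the absolute value only turns it into a
   natural number. *)
Definition inflated_eulerian (R : realType) (s : nat -> nat) (n : nat) :
    {poly int} :=
  \sum_(l \in lattice_points (parallelepiped R s n))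
    ('X^`|last_coord l| : {poly int}).

(* For a = (a_0, ..., a_d) we have [size a = d + 1]; the strict descent
   a_t > a_(t+1) is required only when t < d. *)
Definition unimodal (a : seq int) : Prop :=
  exists t : nat,
    [/\ (t < size a)%N,
        forall i : nat, (i < t)%N -> a`_i <= a`_i.+1,
        (t.+1 < size a)%N -> a`_t > a`_t.+1
      & forall i : nat, (t < i)%N -> (i.+1 < size a)%N -> a`_i >= a`_i.+1].

Definition unimodal_poly (p : {poly int}) : Prop := unimodal (polyseq p).

(* Main.v *)
Require Import Defs.
From mathcomp Require Import all_boot all_order all_algebra.
From mathcomp Require Import reals.
From mathcomp Require Import classical_sets fsbigop zify ring.

(** The lattice points of the parallelepiped are the integer vectors with
    0 <= l_j / s_j - l_(j-1) / s_(j-1) < 1, where l_0 / s_0 is read as 0 / 1.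
    Hence, with w = s_(n-1) and w' = s_n, the coefficient of x^k in Q_n is the
    sum of the w consecutive coefficients of Q_(n-1) ending at the index
    floor (k w / w').  Unimodality, in the form "f j >= min (f i) (f k) for
    i <= j <= k", is preserved by sums over a sliding window and by composition
    with a nondecreasing function. *)

Set Implicit Arguments.
Unset Strict Implicit.
Unset Printing Implicit Defensive.

Import Order.TTheory GRing.Theory Num.Theory.

(** * Quasiconcave sequences and sliding windows *)

Definition quasiconcave (f : nat -> nat) : Prop :=
  forall i j k, i <= j <= k -> minn (f i) (f k) <= f j.

Lemma exists_step_lt (f : nat -> nat) (i j : nat) :
  i <= j -> f i < f j -> exists2 m, i <= m < j & f m < f m.+1.
Proof.
elim: j => [|j IH]; first by case: i => // _; rewrite ltnn.
rewrite leq_eqVlt => /predU1P[->|]; first by rewrite ltnn.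
rewrite ltnS => ij fij; have [lt|ge] := ltnP (f j) (f j.+1); first by exists j; lia.
by have [||m mij fm] := IH; [|lia|exists m; lia].
Qed.

Lemma exists_step_gt (f : nat -> nat) (i j : nat) :
  i <= j -> f j < f i -> exists2 m, i <= m < j & f m.+1 < f m.
Proof.
elim: j => [|j IH]; first by case: i => // _; rewrite ltnn.
rewrite leq_eqVlt => /predU1P[->|]; first by rewrite ltnn.
rewrite ltnS => ij fij; have [lt|ge] := ltnP (f j.+1) (f j); first by exists j; lia.
by have [||m mij fm] := IH; [|lia|exists m; lia].
Qed.

(** Moving the window one place gains the value m + 1 and loses m + 1 - w; when w > m + 1 nothing
    leaves, and the test keeps truncated subtraction out. *)
Lemma count_window_succ (h : seq nat) (w m : nat) : 0 < w ->
  count (fun a => a <= m.+1 < a + w) h +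
    (if w <= m.+1 then count_mem (m.+1 - w) h else 0) =
  count (fun a => a <= m < a + w) h + count_mem m.+1 h.
Proof.
move=> w0; elim: h => [|a h IH] /=; first by case: ifP.
case: (leqP w m.+1) IH; case: (leqP a m.+1); case: (leqP a m);
  case: (ltnP m.+1 (a + w)); case: (ltnP m (a + w));
  case: (eqVneq a m.+1); case: (eqVneq a (m.+1 - w)); rewrite /=; lia.
Qed.

Lemma quasiconcave_window (h : seq nat) (w : nat) : 0 < w ->
  quasiconcave (fun k => count_mem k h) ->
  quasiconcave (fun m => count (fun a => a <= m < a + w) h).
Proof.
pose W m := count (fun a => a <= m < a + w) h.
rewrite -/W => w0 qc i j k /andP[ij jk]; rewrite leqNgt; apply/negP.
rewrite leq_min => /andP[ltji ltjk].
have [m mij dm] := exists_step_gt ij ltji.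
have [p pjk dp] := exists_step_lt jk ltjk.
have := count_window_succ h m w0; have := count_window_succ h p w0.
rewrite -/(W m) -/(W p) -/(W m.+1) -/(W p.+1).
case: (leqP w p.+1) => wp; case: (leqP w m.+1) => wm; try lia.
(* With c the counts in [h], the descent at m gives c(m+1) < c(m+1-w) and the later ascent at p
   gives c(p+1-w) < c(p+1). Both m+1 and p+1-w lie between m+1-w and p+1, so whichever end has the
   smaller count, one of them violates [qc]. *)
have := qc (m.+1 - w) m.+1 p.+1; have := qc (m.+1 - w) (p.+1 - w) p.+1.
lia.
Qed.

Lemma quasiconcave_comp (f g : nat -> nat) :
  {homo g : i j / i <= j} -> quasiconcave f -> quasiconcave (f \o g).
Proof.
by move=> gm qf i j k /andP[ij jk] /=; apply: qf; rewrite !gm.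
Qed.

(* The peak is taken at the last index of the maximum, to make the first
   descent strict. *)
Lemma quasiconcave_unimodal (f : nat -> nat) (a : seq int) :
  0 < size a -> quasiconcave f ->
  (forall k, (a`_k)%R = Posz (f k)) -> unimodal a.
Proof.
move=> a0 qf af.
pose M := \max_(i < size a) f i.
have fM i : i < size a -> f i <= M.
  by move=> ia; rewrite /M (leq_bigmax (Ordinal ia)).
have exM : exists t, (t < size a) && (f t == M).
  have [//|t Mt] := @bigop.eq_bigmax _ (fun i : 'I_(size a) => f i).
    by rewrite card_ord.
  by exists t; rewrite ltn_ord -Mt eqxx.
have ubM t : (t < size a) && (f t == M) -> t <= size a.
  by case/andP=> /ltnW.
have [t /andP[ta /eqP ft] tmax] := ex_maxnP exM ubM.
exists t; split=> //.
- move=> i it; rewrite !af; have := qf i i.+1 t; have := fM i.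
  by rewrite ft; lia.
- move=> t1; rewrite !af; have := fM _ t1; have := tmax t.+1.
  by rewrite t1 /= ltnn ft; lia.
- move=> i it i1; rewrite !af; have := qf t i i.+1; have := fM _ i1.
  by rewrite ft; lia.
Qed.

(* [b / w'] lies in the half-open unit interval starting at [a / w]. *)
Definition unit_step (w w' a b : nat) : bool :=
  a * w' <= b * w < (a + w) * w'.

Lemma unit_stepE (w w' a b : nat) : 0 < w' ->
  unit_step w w' a b = (a <= b * w %/ w' < a + w).
Proof. by move=> w'0; rewrite /unit_step leq_divRL // ltn_divLR. Qed.

(* [s 0] is arbitrary; the denominator 1 at index 0 makes the first coordinate
   obey the same rule as the others. *)
Definition den (s : nat -> nat) (i : nat) : nat := if i is 0 then 1 else s i.

(** These are the tuples (l_1, ..., l_n) of lattice points. The [iota] bound only makes the search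
    finite: [unit_step] already implies it when the denominator is positive. *)
Fixpoint chains (s : nat -> nat) (n : nat) : seq (seq nat) :=
  if n is m.+1 then
    [seq rcons x b | x <- chains s m,
       b <- [seq b <- iota 0 ((last 0 x + den s m) * s n)
            | unit_step (den s m) (s n) (last 0 x) b]]
  else [:: [::]].

(** * Enumeration of the chains and the recurrence for their last entries *)

Section Chains.
Variable s : nat -> nat.
Hypothesis s_gt0 : forall i, 0 < i -> 0 < s i.

Lemma den_gt0 i : 0 < den s i.
Proof. by case: i => //= i; apply: s_gt0. Qed.

Lemma mem_steps m x b :
  (b \in [seq b <- iota 0 ((last 0 x + den s m) * s m.+1)
         | unit_step (den s m) (s m.+1) (last 0 x) b]) =
  unit_step (den s m) (s m.+1) (last 0 x) b.
Proof.
rewrite mem_filter mem_iota /= add0n andb_idr // => /andP[_].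
by apply: leq_ltn_trans; rewrite leq_pmulr ?den_gt0.
Qed.

(** Prepending 0 supplies l_0 and shifts indices, so entry i of [0 :: x] is the predecessor of entry
    i of [x]. *)
Lemma mem_chainsP n x :
  reflect (size x = n /\ forall i, i < n ->
             unit_step (den s i) (s i.+1) (nth 0 (0 :: x) i) (nth 0 x i))
          (x \in chains s n).
Proof.
elim: n x => [|n IH] x.
  by rewrite inE; apply: (iffP eqP) => [-> //|[/size0nil]].
apply: (iffP allpairsPdep) => [[y [b [/IH[yn ystep]]]]|[xn xstep]].
  rewrite mem_steps => bstep ->; rewrite size_rcons yn; split=> // i.
  rewrite ltnS leq_eqVlt -rcons_cons !nth_rcons /= yn => /predU1P[->|ilt].
    by rewrite ltnn eqxx ltnSn; move: bstep; rewrite (last_nth 0) yn.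
  by rewrite ilt ltnS (ltnW ilt); apply: ystep.
case/lastP: x => [//|y b] in xn xstep *.
move: xn; rewrite size_rcons => -[yn].
have ystep i : i <= n ->
    unit_step (den s i) (s i.+1) (nth 0 (0 :: y) i) (nth 0 (rcons y b) i).
  by move=> ilt; have := xstep i ilt; rewrite -rcons_cons nth_rcons /= yn ltnS ilt.
exists y, b; split=> //.
  apply/IH; split=> // i ilt; have := ystep i (ltnW ilt).
  by rewrite nth_rcons yn ilt.
rewrite mem_steps; have := ystep n (leqnn n).
by rewrite nth_rcons yn ltnn eqxx (last_nth 0) yn.
Qed.

Lemma chains_uniq n : uniq (chains s n).
Proof.
elim: n => [//|n IH] /=; apply: allpairs_uniq_dep => //.
  by move=> x _; rewrite filter_uniq // iota_uniq.
by move=> [x b] [y c] _ _ /= /rcons_inj[-> ->].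
Qed.

(** A chain ending in a extends by k in at most one way, exactly when [unit_step] holds, that is,
    when the floor falls in the window starting at a. *)
Lemma count_chainsS n k :
  count_mem k (map (last 0) (chains s n.+1)) =
  count (fun a => a <= k * den s n %/ s n.+1 < a + den s n)
    (map (last 0) (chains s n)).
Proof.
rewrite [chains s n.+1]/= map_allpairs count_flatten -map_comp.
rewrite count_map -sumn_count; congr sumn; apply: eq_map => x /=.
rewrite -unit_stepE ?s_gt0 // -mem_steps; set r := [seq b <- _ | _].
rewrite (eq_map (g := id)) => [|b]; last by rewrite last_rcons.
by rewrite map_id count_uniq_mem // filter_uniq // iota_uniq.
Qed.

Lemma quasiconcave_chains n :
  quasiconcave (fun k => count_mem k (map (last 0) (chains s n))).
Proof.
(* The empty chain has last entry 0 by default, so the initial counts are 1, 0, 0, ... *)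
elim: n => [|n IH]; first by move=> i j k /=; lia.
have := quasiconcave_comp _ (quasiconcave_window (den_gt0 n) IH).
move=> /(_ (fun k => k * den s n %/ s n.+1)) qc i j k ijk.
rewrite !count_chainsS; apply: qc => // p q pq.
by rewrite leq_div2r // leq_mul2r pq orbT.
Qed.

Lemma zero_chain n : nseq n 0 \in chains s n.
Proof.
apply/mem_chainsP; rewrite size_nseq; split=> // i ilt.
by rewrite -[0 :: nseq n 0]/(nseq n.+1 0) !nth_nseq !if_same /unit_step
  add0n muln_gt0 den_gt0 s_gt0.
Qed.

End Chains.

(** * From lattice points to chains, and the coefficients *)

Local Open Scope ring_scope.

(** Only the first j + 1 vectors reach coordinate j, all with the same entry there. Indexing [beta]
    by [nat] allows partial sums of every length. *)
Lemma sum_pvecE (R : realType) (s : nat -> nat) (n : nat) (beta : nat -> R)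
    (j : 'I_n) :
  (\sum_(i < n) beta i *: pvec R s i) 0 j =
  (s j.+1)%:R * \sum_(i < j.+1) beta i.
Proof.
rewrite summxE (big_ord_widen_cond n xpredT beta) //= mulr_sumr big_mkcond /=.
rewrite [RHS]big_mkcond /=; apply: eq_bigr => i _.
by rewrite !mxE ltnS; case: ifP; rewrite ?mulr0 // mulrC.
Qed.

Lemma unit_step_ratio (R : realType) (w w' a b : nat) :
  (0 < w)%N -> (0 < w')%N ->
  unit_step w w' a b = (0 <= (b%:R / w'%:R : R) - a%:R / w%:R < 1).
Proof.
move=> w0 w'0; have ww : 0 < (w * w')%:R :> R by rewrite ltr0n muln_gt0 w0.
have wN0 : w%:R != 0 :> R by rewrite pnatr_eq0 -lt0n.
have w'N0 : w'%:R != 0 :> R by rewrite pnatr_eq0 -lt0n.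
have -> : b%:R / w'%:R - a%:R / w%:R =
    ((b * w)%:R - (a * w')%:R) / (w * w')%:R :> R.
  by rewrite !natrM; field; rewrite wN0 w'N0.
rewrite pmulr_lge0 ?invr_gt0 // ltr_pdivrMr // mul1r subr_ge0 ltrBlDl.
by rewrite -natrD ler_nat ltr_nat -mulnDl.
Qed.

Definition chain_row (n : nat) (x : seq nat) : 'rV[int]_n :=
  \row_(j < n) (nth 0%N x j)%:Z.

Lemma chain_row_inj (n : nat) :
  {in [pred x | size x == n] &, injective (chain_row n)}.
Proof.
move=> x y /eqP xn /eqP yn /rowP exy; apply: (@eq_from_nth _ 0%N).
  by rewrite yn.
by move=> i; rewrite xn => ilt; have := exy (Ordinal ilt); rewrite !mxE => -[].
Qed.

(** Each coordinate divided by its s_j is a partial sum of the coefficients, so these are the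
    differences of consecutive ratios, and [unit_step] says that they lie in [0, 1). *)
Lemma lattice_points_chains (R : realType) (s : nat -> nat) (n : nat) :
  (forall i, (0 < i)%N -> (0 < s i)%N) ->
  lattice_points (parallelepiped R s n) =
  [set` map (chain_row n) (chains s n)]%classic.
Proof.
move=> s_gt0; apply/seteqP; split=> l /=.
  (* Dimension 0 is separate because [inord] needs a nonempty ordinal type. *)
  case: n l => [|n] l.
    by move=> _; apply/mapP; exists [::]; [rewrite inE|apply/rowP; case].
  case=> alpha [alpha01 lE].
  pose beta i := alpha (inord i).
  have {}lE (j : 'I_n.+1) : (l 0 j)%:~R = (s j.+1)%:R * \sum_(i < j.+1) beta i :> R.
    rewrite -sum_pvecE; move/rowP: lE => /(_ j); rewrite mxE => ->.
    by congr (fun_of_matrix _ _ _); apply: eq_bigr => i _; rewrite /beta inord_val.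
  have S0 j : 0 <= \sum_(i < j) beta i.
    by apply: sumr_ge0 => i _; case/andP: (alpha01 (inord i)).
  have sN0 i : (s i.+1)%:R != 0 :> R by rewrite pnatr_eq0 -lt0n s_gt0.
  pose x := mkseq (fun j => `|l 0%R (inord j)|%N) n.+1.
  have l0 (j : 'I_n.+1) : 0 <= l 0 j.
    by rewrite -(ler_int R) lE mulr_ge0 ?ler0n.
  have xE j : (j < n.+1)%N -> (nth 0%N x j)%:R / (s j.+1)%:R = \sum_(i < j.+1) beta i :> R.
    move=> jn; rewrite nth_mkseq // natr_absz ger0_norm // lE inordK //.
    by rewrite mulrC mulKf.
  apply/mapP; exists x.
    apply/(mem_chainsP s_gt0); rewrite size_mkseq; split=> // j jn.
    rewrite (unit_step_ratio R) ?den_gt0 ?s_gt0 //.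
    have -> : (nth 0%N (0%N :: x) j)%:R / (den s j)%:R = \sum_(i < j) beta i :> R.
      by case: j jn => [|j] jn /=; rewrite ?mul0r ?big_ord0 // xE // ltnW.
    by rewrite xE // big_ord_recr /= addrAC subrr add0r; apply: alpha01.
  by apply/rowP => j; rewrite mxE nth_mkseq // inord_val gez0_abs.
case/mapP=> x /(mem_chainsP s_gt0)[xn xstep] ->.
pose rho i : R := (nth 0%N (0%N :: x) i)%:R / (den s i)%:R.
(* The sums telescope, and [rho 0] is 0 / 1. *)
exists (fun i => rho i.+1 - rho i); split=> [i|].
  by rewrite -unit_step_ratio ?den_gt0 ?s_gt0 //; apply: xstep.
apply/rowP => j.
rewrite (sum_pvecE s (fun i => rho i.+1 - rho i)) !mxE.
rewrite -(big_mkord xpredT (fun i => rho i.+1 - rho i)) telescope_sumr //.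
rewrite /rho /= mul0r subr0 mulrC mulfVK //.
by rewrite pnatr_eq0 -lt0n s_gt0.
Qed.

Lemma coef_inflated_eulerian (R : realType) (s : nat -> nat) (n k : nat) :
  (forall i, (0 < i)%N -> (0 < s i)%N) ->
  (inflated_eulerian R s n.+1)`_k =
  Posz (count_mem k (map (last 0%N) (chains s n.+1))).
Proof.
move=> s_gt0; rewrite /inflated_eulerian lattice_points_chains //.
(* Chains of equal length give distinct rows, so the sum over the set is a sum over a duplicate-free
   list. *)
rewrite -fsbig_seq; last first.
  rewrite map_inj_in_uniq ?chains_uniq // => x y xC yC.
  by apply: chain_row_inj; apply/eqP; [case/(mem_chainsP s_gt0): xC
                                      |case/(mem_chainsP s_gt0): yC].
rewrite big_map coef_sum count_map -sum1_count (big_morph _ PoszD (erefl _)).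
rewrite [RHS]big_mkcond /= big_seq [RHS]big_seq; apply: eq_bigr => x.
move=> /(mem_chainsP s_gt0 n.+1 x)[xn _].
rewrite coefXn mxE absz_nat (last_nth 0%N) xn /= eq_sym.
by case: eqP.
Qed.

Theorem theorem1p6 (R : realType) (s : nat -> nat)
    (hs : forall i : nat, (1 <= i)%N -> (0 < s i)%N)
    (n : nat) (hn : (1 <= n)%N) :
  unimodal_poly (inflated_eulerian R s n).
Proof.
case: n hn => // n _.
have coefE k := coef_inflated_eulerian R n k hs.
apply: (quasiconcave_unimodal _ (quasiconcave_chains hs n.+1) coefE).
(* The coefficient list is nonempty: the zero chain makes the constant coefficient positive. *)
rewrite lt0n size_poly_eq0; apply/eqP => Q0.
have := coefE 0%N; rewrite Q0 coef0 => /esym/eqP.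
rewrite eqz_nat; apply/negP; rewrite -lt0n -has_count has_pred1.
apply/mapP; exists (nseq n.+1 0%N); first exact: zero_chain.
by elim: n {coefE Q0} => //=.
Qed.
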